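(* Let $k\ge 2$ be an integer, let $f:\mathbb{R}^{k-1}\to\mathbb{R}$ be any function, and let $h:\mathbb{R}^{k!}\to\mathbb{R}$ be any symmetric function of $k!$ variables (i.e. invariant under all permutations of its arguments). For $\sigma\in S_k$ with $\rho(\sigma)=(a_{i,j})$, put $$f_\sigma(x_1,\dots,x_{k-1})=f\left(\sum_{j=1}^{k-1}a_{1,j}x_j,\ \dots,\ \sum_{j=1}^{k-1}a_{k-1,j}x_j\right),$$ and let $\tilde f:\mathbb{R}^{k-1}\to\mathbb{R}$ be the function obtained by plugging the $k!$ values $f_\sigma(x_1,\dots,x_{k-1})$, $\sigma\in S_k$, into the variables of $h$. Then $\tilde f$ is a symmetrization of $f$, i.e. it satisfies all of the required symmetries: for every $\tau\in S_k$ with $\rho(\tau)=(b_{i,j})$ and all $(x_1,\dots,x_{k-1})\in\mathbb{R}^{k-1}$, $$\tilde f(x_1,\dots,x_{k-1})=\tilde f\left(\sum_{j=1}^{k-1}b_{1,j}x_j,\ \dots,\ \sum_{j=1}^{k-1}b_{k-1,j}x_j\right).$$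
   Context: $S_k$ is the group of permutations of $\{1,\dots,k\}$, with products composed from right to left, $(\sigma\tau)(i)=\sigma(\tau(i))$. A permutation $\sigma\in S_k$ acts on a vector $v=(v_1,\dots,v_k)\in\mathbb{R}^k$ by moving the entry in position $i$ to position $\sigma(i)$, i.e. $(\sigma v)_{\sigma(i)}=v_i$. Let $\psi:\mathbb{R}^k\to\mathbb{R}^{k-1}$ be given by $\psi(x_1,x_2,\dots,x_k)=(x_2-x_1,\dots,x_k-x_1)$. Definition of $\rho(\sigma)$: for $\sigma\in S_k$, $\rho(\sigma)=(a_{i,j})$ is the $(k-1)\times(k-1)$ real matrix such that, for all $(x_1,\dots,x_{k-1})\in\mathbb{R}^{k-1}$, the $i$-th coordinate of $\psi\big(\sigma(0,x_1,\dots,x_{k-1})\big)$ equals $\sum_{j=1}^{k-1}a_{i,j}x_j$. For example, for $k=3$ and $\sigma=(12)$: $(0,x,y)\mapsto(x,0,y)\mapsto(-x,y-x)$, so $\rho(\sigma)=\begin{pmatrix}-1&0\\-1&1\end{pmatrix}$. The ''required symmetries'' of a function $g:\mathbb{R}^{k-1}\to\mathbb{R}$ (those of the $k$-th order auto-cumulant function of a $k$-th order stationary time series) are the identities $g(x)=g(\rho(\tau)x)$ for all $x\in\mathbb{R}^{k-1}$ (as column vectors) and all $\tau\in S_k$. *)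

(* Defs.v *)
From mathcomp Require Import all_boot all_order all_fingroup all_algebra.
From mathcomp Require Import reals.

(* Throughout k = n.+1, so that S_k is 'S_n.+1 and R^(k-1) is
   'cV[R]_n; the positions 1, ..., k are the ordinals 0, ..., n. *)

Set Implicit Arguments.
Unset Strict Implicit.
Unset Printing Implicit Defensive.
Import Order.TTheory GRing.Theory Num.Theory.
Local Open Scope ring_scope.

Section Rho.
Variables (R : realType) (n : nat).

(* The inverse is what makes s move the entry in position i to position s i
   (see perm_actE). *)
Definition perm_act (s : 'S_n.+1) (v : 'cV[R]_n.+1) : 'cV[R]_n.+1 :=
  \col_i v ((s^-1)%g i) 0.

Lemma perm_actE s v i : perm_act s v (s i) 0 = v i 0.
Proof. by rewrite mxE permK. Qed.

Definition psi (v : 'cV[R]_n.+1) : 'cV[R]_n :=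
  \col_i (v (lift ord0 i) 0 - v ord0 0).

Definition prepend0 (x : 'cV[R]_n) : 'cV[R]_n.+1 :=
  \col_i (if unlift ord0 i is Some j then x j 0 else 0).

(* The matrix of the linear map x |-> psi (s (0, x)), given by its columns;
   rhoP is the property that defines rho s. *)
Definition rho (s : 'S_n.+1) : 'M[R]_n :=
  \matrix_(i, j) psi (perm_act s (prepend0 (delta_mx j 0))) i 0.

Lemma rhoP (s : 'S_n.+1) (A : 'M[R]_n) :
  A = rho s <->
  forall (x : 'cV[R]_n) (i : 'I_n),
    psi (perm_act s (prepend0 x)) i 0 = \sum_j A i j * x j 0.
Proof.
have pre0 (x : 'cV[R]_n) (i : 'I_n.+1) :
    prepend0 x i 0 = \sum_j prepend0 (delta_mx j 0) i 0 * x j 0.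
  rewrite mxE; case: unliftP => [j | ] ->; last first.
    by rewrite big1 // => l _; rewrite mxE unlift_none mul0r.
  rewrite (bigD1 j) //= !mxE liftK mxE !eqxx mul1r big1 ?addr0 // => l lj.
  by rewrite mxE liftK mxE eq_sym (negPf lj) mul0r.
split=> [-> x i | AP].
  have psiE y : psi (perm_act s (prepend0 y)) i 0 =
      prepend0 y ((s^-1)%g (lift ord0 i)) 0 - prepend0 y ((s^-1)%g ord0) 0.
    by rewrite !mxE.
  rewrite psiE (pre0 x) [X in _ - X]pre0 -sumrB; apply: eq_bigr => j _.
  by rewrite [rho s i j]mxE psiE mulrBl.
apply/matrixP=> i j; rewrite [RHS]mxE AP (bigD1 j) //= mxE !eqxx mulr1.
by rewrite big1 ?addr0 // => l lj; rewrite mxE (negPf lj) mulr0.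
Qed.

Definition required_symmetries (g : 'cV[R]_n -> R) : Prop :=
  forall (t : 'S_n.+1) (x : 'cV[R]_n), g x = g (rho t *m x).

End Rho.

Definition symmetric_fun (R : realType) (N : nat) (h : 'rV[R]_N -> R) : Prop :=
  forall (s : 'S_N) (v : 'rV[R]_N), h (\row_i v 0 (s i)) = h v.

Definition f_perm (R : realType) (n : nat) (f : 'cV[R]_n -> R)
    (s : 'S_n.+1) (x : 'cV[R]_n) : R :=
  f (rho R s *m x).

(* e is the order in which the permutations are assigned to the variables
   of h; bijective orders exist by Sn_enumeration. *)
Definition symmetrize (R : realType) (n : nat) (f : 'cV[R]_n -> R)
    (h : 'rV[R]_((n.+1)`!) -> R) (e : 'I_((n.+1)`!) -> 'S_n.+1)
    (x : 'cV[R]_n) : R :=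
  h (\row_i f_perm f (e i) x).

Lemma Sn_enumeration (n : nat) : exists e : 'I_n`! -> 'S_n, bijective e.
Proof.
have cardS : n`! = #|{: 'S_n}|.
  by rewrite -{1}(card_Sn n); apply: eq_card => s; rewrite !inE.
exists (fun i => enum_val (cast_ord cardS i)).
exists (fun s => cast_ord (esym cardS) (enum_rank s)) => [i | s].
  by rewrite enum_valK cast_ordK.
by rewrite cast_ordKV enum_rankK.
Qed.

(* Main.v *)
Require Import Defs.
From mathcomp Require Import all_boot all_order all_fingroup all_algebra.
From mathcomp Require Import reals.

(* Since psi kills constant vectors, psi (s v) depends on v only through
   psi v, so rho is a representation of S_k. Replacing x by rho(t) x therefore
   turns f_s into f_(s t), which only permutes the arguments of h. *)

Import GRing.Theory.

Lemma psi_perm_act (R : realType) (n : nat) (s : 'S_n.+1) (v : 'cV[R]_n.+1) :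
  psi (perm_act s v) = (rho R s *m psi v)%R.
Proof.
(* This is [v] shifted by a constant vector; the shift cancels in the differences that [psi]
   takes. *)
have pre0 i : prepend0 (psi v) i 0%R = (v i 0 - v ord0 0)%R.
  by rewrite mxE; case: unliftP => [j|] ->; rewrite ?mxE ?subrr.
apply/colP => i.
have psiE w : psi (perm_act s w) i 0%R =
    (w ((s^-1)%g (lift ord0 i)) 0 - w ((s^-1)%g ord0) 0)%R by rewrite !mxE.
rewrite [RHS]mxE -(proj1 (rhoP s (rho R s)) erefl (psi v) i).
by rewrite !psiE !pre0 opprB addrA subrK.
Qed.

(** Since [psi] is onto, products of [rho] can be computed with [perm_act]. *)
Lemma psi_prepend0 (R : realType) (n : nat) (x : 'cV[R]_n) :
  psi (prepend0 x) = x.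
Proof. by apply/colP => i; rewrite !mxE liftK unlift_none subr0. Qed.

Lemma perm_actM (R : realType) (n : nat) (s t : 'S_n.+1) (v : 'cV[R]_n.+1) :
  perm_act (t * s)%g v = perm_act s (perm_act t v).
Proof. by apply/colP => i; rewrite !mxE invMg permM. Qed.

(* The product of 'S_n composes from left to right. *)
Lemma mulmx_rho (R : realType) (n : nat) (s t : 'S_n.+1) (x : 'cV[R]_n) :
  (rho R s *m (rho R t *m x) = rho R (t * s)%g *m x)%R.
Proof. by rewrite -[x]psi_prepend0 -!psi_perm_act perm_actM. Qed.

Theorem corollary2 (R : realType) (n : nat) (hk : (2 <= n.+1)%N)
    (f : 'cV[R]_n -> R) (h : 'rV[R]_((n.+1)`!) -> R) (hsym : symmetric_fun h)
    (e : 'I_((n.+1)`!) -> 'S_n.+1) (he : bijective e) :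
  required_symmetries (symmetrize f h e).
Proof.
move=> t x; case: he => e' eK e'K.
(* Argument [i] of [h] at [rho R t *m x] is the value for [t * e i] at [x], which sits at index
   [e' (t * e i)]. *)
have p_inj : injective (fun i => e' (t * e i)%g).
  exact: inj_comp (can_inj e'K) (inj_comp (mulgI t) (can_inj eK)).
rewrite /symmetrize -(hsym (perm p_inj)); congr h; apply/rowP => i.
by rewrite !mxE permE e'K /f_perm mulmx_rho.
Qed.
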